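(* Let $\Lambda$ be an arbitrary ring. The injective torsion functor $\mathfrak{s}$ on right $\Lambda$-modules is a radical, i.e., $\mathfrak{s}(A/\mathfrak{s}(A))=\{0\}$ for every right $\Lambda$-module $A$.
   Context: $\Lambda$ is an arbitrary ring with identity and $\iota:\Lambda\to I$ is the injective envelope of $\Lambda$ viewed as a left $\Lambda$-module. For a right $\Lambda$-module $A$, the injective torsion is $\mathfrak{s}(A):=\ker\big(1\otimes\iota: A\otimes_\Lambda\Lambda\to A\otimes_\Lambda I\big)$, identified with a submodule of $A$ via $A\otimes_\Lambda\Lambda\cong A$. *)

(* Defs.v *)
From HB Require Import structures.
From mathcomp Require Import all_boot all_algebra.
From mathcomp Require Import boolp.
From mathcomp Require Import freeg.

Set Implicit Arguments.
Unset Strict Implicit.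
Unset Printing Implicit Defensive.

Import GRing.Theory.
Local Open Scope ring_scope.
Local Open Scope quotient_scope.

(* A right R-module is a left module over the converse ring R^c: there,
   x * y is the product y * x of R, so that (a r) s = a (r s) is scalerA. *)
Notation rmodType R := (lmodType R^c).

Definition rscale (R : pzRingType) (A : rmodType R) (a : A) (r : R) : A :=
  (r : R^c) *: a.

Notation "a *> r" := (rscale a r) (at level 40, left associativity) : ring_scope.

Lemma rscaleA (R : pzRingType) (A : rmodType R) (a : A) (r s : R) :
  a *> r *> s = a *> (r * s).
Proof. exact: scalerA. Qed.

Section Tensor.
Variables (R : pzRingType) (A : rmodType R) (M : lmodType R).

(* The subgroup of the free abelian group on A * M generated by the
   elements that a balanced biadditive map must kill. *)
Inductive tensor_null : {freeg (A * M)%type} -> Prop :=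
| TensorNull0 : tensor_null 0
| TensorNullB x y : tensor_null x -> tensor_null y -> tensor_null (x - y)
| TensorNullDl a b m :
    tensor_null (<<((a + b : A), m)>> - <<(a, m)>> - <<(b, m)>>)
| TensorNullDr a m n :
    tensor_null (<<(a, (m + n : M))>> - <<(a, m)>> - <<(a, n)>>)
| TensorNullA a r m :
    tensor_null (<<((a *> r : A), m)>> - <<(a, (r *: m : M))>>).

Definition tensor_ker : {pred {freeg (A * M)%type}} :=
  [pred x | `[< tensor_null x >]].

Lemma tensor_ker_zmod : zmod_closed tensor_ker.
Proof.
split=> [|x y]; rewrite !inE; first by apply/asboolP; constructor.
by move=> /asboolP xN /asboolP yN; apply/asboolP; constructor.
Qed.

HB.instance Definition _ :=
  GRing.isZmodClosed.Build {freeg (A * M)%type} tensor_ker tensor_ker_zmod.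

Definition tensor : Type := Quotient.quot tensor_ker.
HB.instance Definition _ := GRing.Zmodule.on tensor.

Definition tens (a : A) (m : M) : tensor :=
  \pi_(Quotient.quot tensor_ker) (<<(a, m)>> : {freeg (A * M)%type}).

End Tensor.

Notation "A ⊗ M" := (tensor A M) (at level 40, left associativity) : type_scope.
Notation "a ⊗ m" := (tens a m) (at level 40, left associativity) : ring_scope.

Section TensorTheory.
Variables (R : pzRingType) (A : rmodType R) (M : lmodType R).

Lemma tensor_null_eq0 (x : {freeg (A * M)%type}) :
  tensor_null x <-> \pi_(Quotient.quot (@tensor_ker R A M)) x = 0.
Proof.
rewrite -[X in _ = X](raddf0 \pi_(Quotient.quot (@tensor_ker R A M))).
split=> [xN|/eqP].
  by apply/eqP; rewrite -Quotient.idealrBE subr0; apply/asboolP.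
by rewrite -Quotient.idealrBE subr0 => /asboolP.
Qed.

Lemma tensDl (a b : A) (m : M) : (a + b) ⊗ m = a ⊗ m + b ⊗ m.
Proof.
apply/eqP; rewrite -subr_eq0 opprD addrA -!raddfB; apply/eqP/tensor_null_eq0.
exact: TensorNullDl.
Qed.

Lemma tensDr (a : A) (m n : M) : a ⊗ (m + n) = a ⊗ m + a ⊗ n.
Proof.
apply/eqP; rewrite -subr_eq0 opprD addrA -!raddfB; apply/eqP/tensor_null_eq0.
exact: TensorNullDr.
Qed.

Lemma tensA (a : A) (r : R) (m : M) : (a *> r) ⊗ m = a ⊗ (r *: m).
Proof.
apply/eqP; rewrite -subr_eq0 -raddfB; apply/eqP/tensor_null_eq0.
exact: TensorNullA.
Qed.

Lemma tens0l (m : M) : (0 : A) ⊗ m = 0.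
Proof. by apply: (addrI (0 ⊗ m)); rewrite -tensDl !addr0. Qed.

Lemma tensNl (a : A) (m : M) : (- a) ⊗ m = - (a ⊗ m).
Proof. by apply: (addrI (a ⊗ m)); rewrite -tensDl !subrr tens0l. Qed.

Lemma tensor_ind (P : A ⊗ M -> Prop) :
  P 0 -> (forall x y, P x -> P y -> P (x + y)) ->
  (forall a m, P (a ⊗ m)) -> forall x, P x.
Proof.
move=> P0 PD Pt; elim/quotW=> x.
elim/freeg_ind_dom0: x => [|k [a m] x _ _ Px]; first by rewrite raddf0.
rewrite raddfD; apply: (PD) => //.
have Pn n b : P ((b ⊗ m) *+ n).
  by elim: n => [|n IHn]; rewrite ?mulr0n // mulrS; apply: PD.
rewrite -[k]intz -freegU_mulz raddfMz -/(a ⊗ m).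
case: (intP k) => [|n|n]; rewrite ?mulr0z //; first exact: Pn.
by rewrite mulrNz -mulNrz -tensNl; apply: Pn.
Qed.

Definition balanced (V : zmodType) (f : A -> M -> V) : Prop :=
  [/\ forall a b m, f (a + b) m = f a m + f b m,
      forall a m n, f a (m + n) = f a m + f a n
    & forall a r m, f (a *> r) m = f a (r *: m)].

Definition tensor_lift (V : zmodType) (f : A -> M -> V) (x : A ⊗ M) : V :=
  fglift (fun am : A * M => f am.1 am.2 : zmodule V) (repr x).

Section Lift.
Variables (V : zmodType) (f : A -> M -> V) (f_bal : balanced f).

Let liftf : {freeg (A * M)%type} -> V :=
  fglift (fun am : A * M => f am.1 am.2 : zmodule V).

Let liftfB x y : liftf (x - y) = liftf x - liftf y.
Proof. exact: (@lift_is_additive _ _ (zmodule V)). Qed.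

Let liftfU a m : liftf <<(a, m)>> = f a m.
Proof. by rewrite /liftf liftU scale1r. Qed.

Let liftf_null x : tensor_null x -> liftf x = 0.
Proof.
have lift0 : liftf 0 = 0 by have := liftfB 0 0; rewrite !subrr.
have [fDl fDr fA] := f_bal.
elim=> {x} [|x y _ x0 _ y0|a b m|a m n|a r m] //.
- by rewrite liftfB x0 y0 subrr.
- by rewrite !liftfB !liftfU fDl addrAC addrK subrr.
- by rewrite !liftfB !liftfU fDr addrAC addrK subrr.
- by rewrite liftfB !liftfU fA subrr.
Qed.

Let tensor_lift_pi x :
  tensor_lift f (\pi_(Quotient.quot (@tensor_ker R A M)) x) = liftf x.
Proof.
apply/eqP; rewrite -subr_eq0 -liftfB; apply/eqP/liftf_null/tensor_null_eq0.
by rewrite raddfB; apply/eqP; rewrite subr_eq0; apply/eqP; exact: reprK.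
Qed.

Lemma tensor_lift_is_additive : zmod_morphism (tensor_lift f).
Proof.
by elim/quotW=> x; elim/quotW=> y; rewrite -raddfB !tensor_lift_pi liftfB.
Qed.

Lemma tensor_liftE a m : tensor_lift f (a ⊗ m) = f a m.
Proof. by rewrite /tens tensor_lift_pi liftfU. Qed.

End Lift.

End TensorTheory.

Section TensorMap.
Variables (R : pzRingType) (A B : rmodType R) (M N : lmodType R).
Variables (f : {linear A -> B}) (g : {linear M -> N}).

Definition tensor_map : A ⊗ M -> B ⊗ N :=
  tensor_lift (fun a m => f a ⊗ g m).

Lemma tensor_map_balanced : balanced (fun a m => f a ⊗ g m).
Proof.
split=> [a b m|a m n|a r m]; rewrite ?raddfD ?tensDl ?tensDr //.
by rewrite /rscale linearZ linearZ /= -tensA.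
Qed.

HB.instance Definition _ := GRing.isZmodMorphism.Build (A ⊗ M)%type (B ⊗ N)%type
  tensor_map (tensor_lift_is_additive tensor_map_balanced).

Lemma tensor_mapE a m : tensor_map (a ⊗ m) = f a ⊗ g m.
Proof. exact: (tensor_liftE tensor_map_balanced). Qed.

End TensorMap.

Section TensorUnit.
Variables (R : pzRingType) (A : rmodType R).

(* The canonical isomorphism between A ⊗ R and A. *)
Definition tensor_act : A ⊗ R^o -> A :=
  tensor_lift (fun (a : A) (r : R^o) => a *> r).

Lemma tensor_act_balanced : balanced (fun (a : A) (r : R^o) => a *> r).
Proof.
split=> [a b r|a r s|a r s].
- exact: (scalerDr (r : R^c)).
- exact: (scalerDl a (r : R^c)).
- exact: rscaleA.
Qed.

HB.instance Definition _ := GRing.isZmodMorphism.Build (A ⊗ R^o)%type A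
  tensor_act (tensor_lift_is_additive tensor_act_balanced).

Lemma tensor_actE (a : A) (r : R) : tensor_act (a ⊗ (r : R^o)) = a *> r.
Proof. exact: (tensor_liftE tensor_act_balanced). Qed.

Definition tens1 (a : A) : A ⊗ R^o := a ⊗ (1 : R^o).

Lemma tens1K : cancel tens1 tensor_act.
Proof. by move=> a; rewrite tensor_actE /rscale scale1r. Qed.

Lemma tensor_actK : cancel tensor_act tens1.
Proof.
elim/tensor_ind => [|x y xK yK|a r].
- by rewrite raddf0 /tens1 tens0l.
- by rewrite raddfD /tens1 tensDl -/(tens1 _) xK -/(tens1 _) yK.
- by rewrite tensor_actE /tens1 tensA /= [r *: _]mulr1.
Qed.

End TensorUnit.

Section InjectiveEnvelope.
Variable R : pzRingType.

Definition injective_module (I : lmodType R) : Prop :=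
  forall (M N : lmodType R) (f : {linear M -> N}) (g : {linear M -> I}),
    injective f -> exists h : {linear N -> I}, forall x, h (f x) = g x.

Definition essential (M N : lmodType R) (f : {linear M -> N}) : Prop :=
  forall S : submodClosed N, (exists2 y, y \in S & y != 0) ->
  exists2 x, f x \in S & f x != 0.

Record injective_envelope (M : lmodType R) := InjectiveEnvelope {
  env_mod :> lmodType R;
  env_map : {linear M -> env_mod};
  env_map_inj : injective env_map;
  env_mod_inj : injective_module env_mod;
  env_map_ess : essential env_map
}.

End InjectiveEnvelope.

Section InjectiveTorsion.
Variables (R : pzRingType) (E : injective_envelope R^o).

(* The kernel of A ⊗ R -> A ⊗ E, transported to A along tens1. *)
Definition injective_torsion (A : rmodType R) : {pred A} :=
  [pred a | tensor_map (idfun : {linear A -> A}) (env_map E) (tens1 a) == 0].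
Arguments injective_torsion A : clear implicits.

Lemma injective_torsionP (A : rmodType R) (a : A) :
  reflect (a ⊗ env_map E 1 = 0) (a \in injective_torsion A).
Proof. by rewrite inE /tens1 tensor_mapE; apply: eqP. Qed.

Lemma injective_torsion_functor (A B : rmodType R) (f : {linear A -> B}) a :
  a \in injective_torsion A -> f a \in injective_torsion B.
Proof.
move=> /injective_torsionP a0; apply/injective_torsionP.
rewrite -(tensor_mapE f (idfun : {linear E -> E})) a0; exact: raddf0.
Qed.

(* Right multiplication by r is an endomorphism of the left module R, which
   extends to E by injectivity. *)
Lemma injective_torsion_rscale (A : rmodType R) (a : A) (r : R) :
  a \in injective_torsion A -> a *> r \in injective_torsion A.
Proof.
move=> /injective_torsionP a0; apply/injective_torsionP; rewrite tensA.
pose mulr_r (x : R^o) : R^o := (x : R) * r.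
have mulr_r_lin : linear mulr_r.
  by move=> c x y; rewrite /mulr_r [c *: x]/(c * x : R) mulrDl -mulrA.
pose g : {linear R^o -> R^o} :=
  HB.pack mulr_r (GRing.isLinear.Build _ _ _ _ mulr_r mulr_r_lin).
have [h hE] := env_mod_inj (env_map E \o g) (@env_map_inj _ _ E).
have -> : r *: env_map E 1 = h (env_map E 1).
  by rewrite hE /= /mulr_r mul1r -linearZ /= [r *: _]mulr1.
rewrite -(tensor_mapE (idfun : {linear A -> A}) h) a0; exact: raddf0.
Qed.

Lemma injective_torsion_submod (A : rmodType R) :
  submod_closed (injective_torsion A).
Proof.
split=> [|r u v /(injective_torsion_rscale r)/injective_torsionP u0].
  exact/injective_torsionP/tens0l.
move=> /injective_torsionP v0; apply/injective_torsionP.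
by rewrite tensDl v0 addr0.
Qed.

HB.instance Definition _ (A : rmodType R) :=
  GRing.isSubmodClosed.Build R^c A (injective_torsion A)
    (injective_torsion_submod A).

End InjectiveTorsion.
Arguments injective_torsion {R} E A.

Section QuotientModule.
Variables (R : pzRingType) (A : lmodType R) (S : submodClosed A).

(* submodClosed only records closure under addition and scaling; over a ring
   this gives closure under opposite, which Quotient.quot asks for. *)
Definition submod_pred : {pred A} := S.
HB.instance Definition _ := GRing.isZmodClosed.Build A submod_pred
  (GRing.submod_closedB (submodClosedP S)).

Definition quot_module : Type := Quotient.quot submod_pred.
HB.instance Definition _ := GRing.Zmodule.on quot_module.

Definition quot_pi (a : A) : quot_module := \pi_(Quotient.quot submod_pred) a.

Definition quot_scale (r : R) (x : quot_module) : quot_module :=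
  quot_pi (r *: repr x).

Lemma quot_pi_eq (a b : A) : (quot_pi a == quot_pi b) = (a - b \in S).
Proof. by rewrite -Quotient.idealrBE. Qed.

Lemma quot_pi_surj (x : quot_module) : exists a, x = quot_pi a.
Proof. by exists (repr x); rewrite /quot_pi reprK. Qed.

Lemma quot_pi_is_additive : zmod_morphism quot_pi.
Proof. exact: raddfB. Qed.

HB.instance Definition _ :=
  GRing.isZmodMorphism.Build A quot_module quot_pi quot_pi_is_additive.

Lemma quot_scale_pi r a : quot_scale r (quot_pi a) = quot_pi (r *: a).
Proof.
apply/eqP; rewrite quot_pi_eq -scalerBr rpredZ // -quot_pi_eq.
by apply/eqP; apply: reprK.
Qed.

Lemma quot_scaleA r s x : quot_scale r (quot_scale s x) = quot_scale (r * s) x.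
Proof. by have [a ->] := quot_pi_surj x; rewrite !quot_scale_pi scalerA. Qed.

Lemma quot_scale1 : left_id 1 quot_scale.
Proof.
by move=> x; have [a ->] := quot_pi_surj x; rewrite quot_scale_pi scale1r.
Qed.

Lemma quot_scaleDr : right_distributive quot_scale +%R.
Proof.
move=> r x y; have [a ->] := quot_pi_surj x; have [b ->] := quot_pi_surj y.
by rewrite -raddfD !quot_scale_pi scalerDr raddfD.
Qed.

Lemma quot_scaleDl x : {morph quot_scale^~ x : r s / r + s}.
Proof.
move=> r s; have [a ->] := quot_pi_surj x.
by rewrite !quot_scale_pi scalerDl raddfD.
Qed.

HB.instance Definition _ := GRing.Zmodule_isLmodule.Build R quot_module
  quot_scaleA quot_scale1 quot_scaleDr quot_scaleDl.

Lemma quot_pi_is_scalable : scalable quot_pi.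
Proof. by move=> r a; rewrite -quot_scale_pi. Qed.

HB.instance Definition _ :=
  GRing.isScalable.Build R A quot_module *:%R quot_pi quot_pi_is_scalable.

End QuotientModule.

(* Main.v *)
(* Every y in E is h (ι 1) for some endomorphism h of E, because E is
   injective; hence a torsion element a, one with a ⊗ ι 1 = 0, satisfies
   a ⊗ y = 0 for all y.  So A ⊗ E -> A/s(A) ⊗ E has a left inverse, and
   π a ⊗ ι 1 = 0 forces a ⊗ ι 1 = 0. *)

From HB Require Import structures.
Require Import Defs.
From mathcomp Require Import all_boot all_algebra.
Import GRing.Theory.
Local Open Scope ring_scope.

Section InjectiveTorsionQuotient.
Variables (R : pzRingType) (E : injective_envelope R^o) (A : rmodType R).

Lemma injective_envelope_endo (y : E) :
  exists h : {linear E -> E}, h (env_map E 1) = y.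
Proof.
(* Left linear with [1 ↦ y]; its extension along the injection [env_map E] is the required [h]. *)
pose scale_y (r : R^o) : E := (r : R) *: y.
have scale_y_lin : linear scale_y.
  by move=> c u v; rewrite /scale_y scalerDl -scalerA.
pose g : {linear R^o -> E} :=
  HB.pack scale_y (GRing.isLinear.Build _ _ _ _ scale_y scale_y_lin).
have [h hE] := env_mod_inj g (@env_map_inj _ _ E).
by exists h; rewrite hE; exact: scale1r.
Qed.

Lemma injective_torsion_tens0 (a : A) (y : E) :
  a \in injective_torsion E A -> a ⊗ y = 0.
Proof.
move=> /injective_torsionP a0; have [h <-] := injective_envelope_endo y.
(* [id ⊗ h] carries [a ⊗ ι 1 = 0] to [a ⊗ h (ι 1)]. *)
by rewrite -(tensor_mapE (idfun : {linear A -> A}) h) a0; exact: raddf0.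
Qed.

Let B : rmodType R := quot_module (injective_torsion E A).
Let pi : {linear A -> B} := @quot_pi R^c A (injective_torsion E A).

(** Lifts to the left inverse [B ⊗ E -> A ⊗ E]; [repr] is an arbitrary choice. *)
Definition quot_tens (b : B) (y : E) : A ⊗ E := (repr b : A) ⊗ y.

(** [repr (pi a) - a] is torsion, so its tensor with any [y] vanishes. *)
Lemma quot_tens_pi (a : A) (y : E) : quot_tens (pi a) y = a ⊗ y.
Proof.
apply/eqP; rewrite -subr_eq0 -tensNl -tensDl; apply/eqP.
apply: injective_torsion_tens0; rewrite -quot_pi_eq; apply/eqP; exact: reprK.
Qed.

Lemma quot_tens_balanced : balanced quot_tens.
Proof.
split=> [b c y|b y z|b r y].
(* [repr] need not be additive, so the check is made on classes [pi u], [pi v]. *)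
- have [u ->] := quot_pi_surj b; have [v ->] := quot_pi_surj c.
  by rewrite -raddfD !quot_tens_pi tensDl.
- exact: tensDr.
- have [u ->] := quot_pi_surj b.
  by rewrite /rscale -linearZ !quot_tens_pi -tensA.
Qed.

Lemma injective_torsion_quot (a : A) :
  pi a \in injective_torsion E B -> a \in injective_torsion E A.
Proof.
move=> /injective_torsionP a0; apply/injective_torsionP.
(* The lift of [quot_tens] sends [pi a ⊗ ι 1], which is 0, to [a ⊗ ι 1]. *)
rewrite -quot_tens_pi -(tensor_liftE quot_tens_balanced) a0.
have liftB := tensor_lift_is_additive quot_tens_balanced.
by have := liftB 0 0; rewrite !subrr.
Qed.

End InjectiveTorsionQuotient.

Theorem theorem2p19 (R : pzRingType) (E : injective_envelope R^o)
    (A : rmodType R) :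
  injective_torsion E (quot_module (injective_torsion E A)) =i pred1 0.
Proof.
move=> b; rewrite [RHS]inE; apply/idP/eqP => [|->]; last exact: rpred0.
have [a ->] := quot_pi_surj b => /injective_torsion_quot aS.
by apply/eqP; rewrite -(raddf0 (@quot_pi _ _ _)) quot_pi_eq subr0.
Qed.
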